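(* Assume: (i) $\mathbf V$ has rank $N_p$, and $\mathbf W$ and all $\mathbf W^{(\gamma)}$, $\gamma\in\{1,\dots,N_f\}$, are symmetric positive definite; (ii) $\mathbf M^{(\kappa)}$ is invertible for all $\kappa\in\{1,\dots,K\}$; (iii) $\mathcal{M}$ is chosen such that $\mathbf K\mathbf D^{(m)}=\mathbf 0$ for all $m\in\{1,\dots,d\}$, and the coefficients $C(\alpha)$ are chosen such that $\mathbf M+\mathbf K$ is symmetric positive definite; (iv) $\mathcal{V}$ contains the constant functions; (v) the discrete divergence theorem $$\langle 1,\nabla\cdot v\rangle_{\mathbf W}=\sum_{\gamma=1}^{N_f}\langle 1,v\cdot\hat n^{(\gamma)}\rangle_{\mathbf W^{(\gamma)}}\qquad\text{for all }v\in\mathcal{V}^d$$ holds. Let $\mathbf L^{(\gamma)}:=(\mathbf M+\mathbf K)^{-1}(\mathbf V^{(\gamma)})^T\mathbf W^{(\gamma)}$. Let $u^{(h,\kappa,e)}(t)$ satisfy either the strong-form flux reconstruction (FR) method $$\mathbf P\mathbf J^{(\kappa)}\mathbf V\frac{d u^{(h,\kappa,e)}}{dt}+\sum_{m=1}^d\mathbf D^{(m)}\mathbf P f^{(h,\kappa,m,e)}+\sum_{\gamma=1}^{N_f}\mathbf L^{(\gamma)}\Big(f^{( *,\kappa,\gamma,e)}-\sum_{n=1}^d\hat n^{(\gamma)}_n\mathbf V^{(\gamma)}\mathbf P f^{(h,\kappa,n,e)}\Big)=0$$ or the strong-form discontinuous Galerkin (DG) method $$\mathbf M^{(\kappa)}\frac{d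 u^{(h,\kappa,e)}}{dt}+\sum_{m=1}^d\mathbf M\mathbf D^{(m)}\mathbf P f^{(h,\kappa,m,e)}+\sum_{\gamma=1}^{N_f}(\mathbf V^{(\gamma)})^T\mathbf W^{(\gamma)}\Big(f^{( *,\kappa,\gamma,e)}-\sum_{n=1}^d\hat n^{(\gamma)}_n\mathbf V^{(\gamma)}\mathbf P f^{(h,\kappa,n,e)}\Big)=0,$$ for all $\kappa\in\{1,\dots,K\}$, $e\in\{1,\dots,N_{\rm Eq}\}$, $t\in(0,T)$. Then the method is locally conservative: $$\frac{d}{dt}\Big(\mathbf 1^T\mathbf W\mathbf J^{(\kappa)}\mathbf V u^{(h,\kappa,e)}(t)\Big)+\sum_{\gamma=1}^{N_f}\mathbf 1^T\mathbf W^{(\gamma)}f^{( *,\kappa,\gamma,e)}(t)=0$$ for all $\kappa\in\{1,\dots,K\}$, $e\in\{1,\dots,N_{\rm Eq}\}$, $t\in(0,T)$. Moreover, if the numerical flux satisfies $F^*(U,V,n)=-F^*(V,U,-n)$ for all $U,V\in\Upsilon$ and $n\in\mathbb{S}^{d-1}$, and the mesh satisfies the conformity assumption described in the context, then the method is globally conservative: $$\frac{d}{dt}\Big(\sum_{\kappa=1}^K\mathbf 1^T\mathbf W\mathbf J^{(\kappa)}\mathbf V u^{(h,\kappa,e)}(t)\Big)+\sum_{(\kappa,\gamma)\in\mathcal{K}_{\partial\Omega}}\mathbf 1^T\mathbf W^{(\gamma)}f^{( *,\kappa,\gamma,e)}(t)=0$$ for all $e\in\{1,\dots,N_{\rm Eq}\}$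 and $t\in(0,T)$.
   Context: Reference element and operators. $\hat\Omega\subset\mathbb{R}^d$ is a polytope with volume $|\hat\Omega|$, flat facets $\hat\Gamma^{(\gamma)}$, $\gamma\in\{1,\dots,N_f\}$, and outward unit normals $\hat n^{(\gamma)}$. $\mathcal{V}$ is the space of real polynomial functions on $\hat\Omega$ spanned by the monomials $\hat x_1^{\alpha_1}\cdots\hat x_d^{\alpha_d}$ with exponents in a finite set $\mathcal{N}\supseteq\{\alpha\in\mathbb{N}_0^d:|\alpha|\le p\}$ of $N_p$ multi-indices, where $|\alpha|=\alpha_1+\dots+\alpha_d$ and $p\in\mathbb{N}_0$; $\mathcal{V}$ is assumed closed under each $\partial/\partial\hat x_m$. $\{\phi^{(i)}\}_{i=1}^{N_p}$ is an arbitrary basis of $\mathcal{V}$. Volume nodes $\hat x^{(i)}\in\hat\Omega$, $i\in\{1,\dots,N\}$ ($N\ge N_p$), facet nodes $\hat x^{(\gamma,i)}\in\hat\Gamma^{(\gamma)}$, $i\in\{1,\dots,N_\gamma\}$, and matrices $\mathbf W\in\mathbb{R}^{N\times N}$, $\mathbf W^{(\gamma)}\in\mathbb{R}^{N_\gamma\times N_\gamma}$ are given; $\langle u,v\rangle_{\mathbf W}:=\sum_{i,j}u(\hat x^{(i)})W_{ij}v(\hat x^{(j)})$ and $\langle u,v\rangle_{\mathbf W^{(\gamma)}}:=\sum_{i,j}u(\hat x^{(\gamma,i)})W^{(\gamma)}_{ij}v(\hat x^{(\gamma,j)})$. Set $V_{ij}:=\phi^{(j)}(\hat x^{(i)})$,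 $V^{(\gamma)}_{ij}:=\phi^{(j)}(\hat x^{(\gamma,i)})$, $\mathbf M:=\mathbf V^T\mathbf W\mathbf V$, $\mathbf P:=\mathbf M^{-1}\mathbf V^T\mathbf W$, and define $\mathbf D^{(m)}$ by $\partial\phi^{(j)}/\partial\hat x_m=\sum_iD^{(m)}_{ij}\phi^{(i)}$. For a finite set $\mathcal{M}\subset\mathcal{N}$ and $C:\mathcal{M}\to\mathbb{R}$, $\mathbf K:=\sum_{\alpha\in\mathcal{M}}\frac{C(\alpha)}{|\hat\Omega|}(\mathbf D^{(\alpha)})^T\mathbf M\mathbf D^{(\alpha)}$ with $\mathbf D^{(\alpha)}:=(\mathbf D^{(1)})^{\alpha_1}\cdots(\mathbf D^{(d)})^{\alpha_d}$. $\mathbf 1$ is a vector of ones of the appropriate length. Mesh. $\bar\Omega\subset\mathbb{R}^d$ is the union of compact elements $\Omega^{(\kappa)}$, $\kappa\in\{1,\dots,K\}$, with disjoint interiors, each the image of $\hat\Omega$ under a smooth bijective time-independent map $X^{(\kappa)}$ with Jacobian matrix $\boldsymbol{\mathcal J}^{(\kappa)}$ and $\mathcal J^{(\kappa)}:=\det\boldsymbol{\mathcal J}^{(\kappa)}>0$; $\Gamma^{(\kappa,\gamma)}:=X^{(\kappa)}(\hat\Gamma^{(\gamma)})$ is a smooth facet with outward unit normal $n^{(\kappa,\gamma)}$, and $\mathcal J^{(\kappa,\gamma)}(\hat x):=\|\mathcal J^{(\kappa)}(\hat x)(\boldsymbol{\mathcal J}^{(\kappa)}(\hat x))^{-T}\hat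 n^{(\gamma)}\|_2$. $\mathbf J^{(\kappa)}:=\mathrm{diag}(\mathcal J^{(\kappa)}(\hat x^{(1)}),\dots,\mathcal J^{(\kappa)}(\hat x^{(N)}))$, $\mathbf J^{(\kappa,\gamma)}:=\mathrm{diag}(\mathcal J^{(\kappa,\gamma)}(\hat x^{(\gamma,1)}),\dots,\mathcal J^{(\kappa,\gamma)}(\hat x^{(\gamma,N_\gamma)}))$ and $\mathbf M^{(\kappa)}:=\mathbf V^T\mathbf W\mathbf J^{(\kappa)}\mathbf V$. Periodic boundaries are treated identically to interior interfaces; $\partial\Omega$ denotes only the non-periodic part of the boundary. $\mathcal{K}_{\partial\Omega}$ is the set of pairs $(\kappa,\gamma)\in\{1,\dots,K\}\times\{1,\dots,N_f\}$ with $\Gamma^{(\kappa,\gamma)}\subset\partial\Omega$, and $\mathcal{K}_\Omega$ is the set of all other pairs, corresponding to facets forming interior or periodic interfaces. Conformity assumption. For each pair of element indices $\kappa,\nu\in\{1,\dots,K\}$ with $\kappa\ne\nu$ such that $\partial\Omega^{(\kappa)}\cap\partial\Omega^{(\nu)}\ne\emptyset$, there exist facet indices $\gamma,\eta\in\{1,\dots,N_f\}$ such that either $\Gamma^{(\kappa,\gamma)}=\Gamma^{(\nu,\eta)}$, or the facets are connected via periodic boundary conditions, in which case $\Gamma^{(\nu,\eta)}$ is the image of $\Gamma^{(\kappa,\gamma)}$ under a pure translation, with opposite orientation in the sense that $n^{(\nu,\eta)}=-n^{(\kappa,\gamma)}$. Moreover, for such corresponding facets, $N_\eta=N_\gamma$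 and there is a permutation $\tau^{(\kappa,\gamma)}$ of $\{1,\dots,N_\gamma\}$ such that $X^{(\kappa)}(\hat x^{(\gamma,i)})=X^{(\nu)}(\hat x^{(\eta,\tau^{(\kappa,\gamma)}(i))})$ for all $i\in\{1,\dots,N_\gamma\}$, with an additional translation in the periodic case. With $\mathbf T^{(\kappa,\gamma)}$ the permutation matrix whose $i$-th row is the $\tau^{(\kappa,\gamma)}(i)$-th standard basis vector of $\mathbb{R}^{N_\gamma}$, it is assumed that $\mathbf W^{(\eta)}\mathbf J^{(\nu,\eta)}=(\mathbf T^{(\kappa,\gamma)})^T\mathbf W^{(\gamma)}\mathbf J^{(\kappa,\gamma)}\mathbf T^{(\kappa,\gamma)}$. Semi-discrete quantities. The conservation law is $\partial_tU+\sum_{m=1}^d\partial_{x_m}F^{(m)}(U)=0$ with $U\in\Upsilon\subseteq\mathbb{R}^{N_{\rm Eq}}$ and $F^{(m)}:\Upsilon\to\mathbb{R}^{N_{\rm Eq}}$. The unknown vectors $u^{(h,\kappa,e)}(t)\in\mathbb{R}^{N_p}$ define $U^{(h,\kappa)}_e(\hat x,t)=\sum_iu^{(h,\kappa,e)}_i(t)\phi^{(i)}(\hat x)$, and $U^{(h,\kappa)}$ is assumed to take values in $\Upsilon$. The vector $f^{(h,\kappa,m,e)}(t)\in\mathbb{R}^N$ has entries equal to the $e$-th component of $\sum_{n=1}^d\mathcal J^{(\kappa)}[(\boldsymbol{\mathcal J}^{(\kappa)})^{-1}]_{mn}F^{(n)}(U^{(h,\kappa)})$ at the nodes $\hat x^{(i)}$;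 the vector $f^{( *,\kappa,\gamma,e)}(t)\in\mathbb{R}^{N_\gamma}$ has entries equal to the $e$-th component of $\mathcal J^{(\kappa,\gamma)}F^*(U^{(h,\kappa)},U^{(+,\kappa,\gamma)},n^{(\kappa,\gamma)}\circ X^{(\kappa)})$ at the nodes $\hat x^{(\gamma,i)}$, where $F^*:\Upsilon\times\Upsilon\times\mathbb{S}^{d-1}\to\mathbb{R}^{N_{\rm Eq}}$ is a numerical flux function and $\mathbb{S}^{d-1}$ is the unit sphere in $\mathbb{R}^d$. $U^{(+,\kappa,\gamma)}$ is the external data of a weakly imposed boundary or interface condition: for $(\kappa,\gamma)\in\mathcal{K}_\Omega$ whose coincident or periodically connected facet is $(\nu,\eta)\in\mathcal{K}_\Omega$, its value at $\hat x^{(\gamma,i)}$ is $U^{(h,\nu)}(\hat x^{(\eta,\tau^{(\kappa,\gamma)}(i))},t)$; for $(\kappa,\gamma)\in\mathcal{K}_{\partial\Omega}$ it is boundary data.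
   Formalization: For the FR method it is additionally assumed that K = 0 when N_p = 1 (V consists only of constants); otherwise the claim fails, e.g. p = 0, M = {0}, C(0) > 0, where all D^(m) = 0 but K is a nonzero multiple of M. The DG part is unchanged. *)

(* Defs.v *)
(* MathComp / MathComp-Analysis; the reals are an arbitrary [R : realType], and
   points of R^d, normals and states are row vectors. *)
From mathcomp Require Import all_boot all_order all_algebra perm finmap.
From mathcomp Require Import all_classical all_reals all_analysis.
Import Order.TTheory GRing.Theory Num.Theory.
Import numFieldNormedType.Exports.

Set Implicit Arguments.
Unset Strict Implicit.
Unset Printing Implicit Defensive.

Local Open Scope classical_set_scope.
Local Open Scope ring_scope.

Definition dotv (R : realType) (d : nat) (u v : 'rV[R]_d) : R :=
  (u *m v^T) 0 0.

(* [`| _ |] on matrices is the max norm, so the Euclidean norm is spelled out. *)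
Definition norm2 (R : realType) (d : nat) (u : 'rV[R]_d) : R :=
  Num.sqrt (dotv u u).

Definition spd (R : realType) (n : nat) (A : 'M[R]_n) : Prop :=
  A^T = A /\ forall x : 'cV[R]_n, x != 0 -> 0 < (x^T *m A *m x) 0 0.

Definition partial (R : realType) (d : nat) (F : normedModType R) (m : 'I_d)
    (f : 'rV[R]_d -> F) : 'rV[R]_d -> F :=
  fun x => 'D_(delta_mx 0 m : 'rV[R]_d) f x.

(* C^oo on a possibly closed set: all iterated partial derivatives exist and are
   differentiable on an open neighbourhood of it. *)
Definition smooth_near (R : realType) (d : nat) (F : normedModType R)
    (A : set 'rV[R]_d) (f : 'rV[R]_d -> F) : Prop :=
  exists U : set 'rV[R]_d, [/\ open U, A `<=` U &
    forall (s : seq 'I_d) x, U x ->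
      differentiable (foldr (@partial R d F) f s) x].

(* n-dimensional Lebesgue measure, as the iterated integral of the indicator
   function (Tonelli); only used on compact sets. *)
Fixpoint volume (R : realType) (n : nat) : set 'rV[R]_n -> \bar R :=
  match n return set 'rV[R]_n -> \bar R with
  | 0 => fun A => if `[< A 0 >] then 1%E else 0%E
  | n'.+1 => fun A =>
      (\int[@lebesgue_measure R]_x
         volume [set y : 'rV[R]_n' | A (row_mx (x%:M : 'rV[R]_1) y)])%E
  end.

(* n is the outward unit normal field along the part G of the boundary of S: it
   is continuous, of unit Euclidean length and orthogonal to the tangent
   directions of G at all points of G, and it points from the interior of S to
   the complement of S at the points of G0.  G0 is the relative interior of the
   facet; on edges and corners the side is determined by continuity. *)
Definition outward_unit_normal (R : realType) (d : nat) (S G G0 : set 'rV[R]_d)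
    (n : 'rV[R]_d -> 'rV[R]_d) : Prop :=
  [/\ {within G, continuous n},
      forall x, G x -> norm2 (n x) = 1,
      forall x, G x -> forall e : R, 0 < e ->
        \forall y \near x, G y -> `|dotv (n x) (y - x)| <= e * `|y - x| &
      forall x, G0 x -> \forall s \near (0 : R)^'+,
        S° (x - s *: n x) /\ ~ S (x + s *: n x)].

Definition facet_interior (R : realType) (d nf : nat)
    (G : 'I_nf -> set 'rV[R]_d) (g : 'I_nf) : set 'rV[R]_d :=
  [set x | G g x /\ forall h, h != g -> ~ G h x].

(* A full-dimensional polytope, not necessarily convex: a compact set which is
   the closure of its interior and whose boundary is covered by finitely many
   flat facets, none of which is redundant. *)
Record polytope (R : realType) (d : nat) := Polytope {
  body : set 'rV[R]_d;
  nfacets : nat;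
  facet : 'I_nfacets -> set 'rV[R]_d;
  normal : 'I_nfacets -> 'rV[R]_d;
  body_compact : compact body;
  body_nonempty : body !=set0;
  body_regular : body = closure body°;
  body_boundary : body `\` body° = \bigcup_g facet g;
  facet_nonempty : forall g, facet g !=set0;
  facet_closure : forall g, facet g = closure (facet_interior facet g);
  facet_flat : forall g x y, facet g x -> facet g y ->
    dotv (normal g) (x - y) = 0;
  facet_normal : forall g,
    outward_unit_normal body (facet g) (facet_interior facet g)
      (fun=> normal g)
}.

Definition mindex (d : nat) := {ffun 'I_d -> nat}.

Definition monomial (R : realType) (d : nat) (a : mindex d) : 'rV[R]_d -> R :=
  fun x => \prod_(i < d) x 0 i ^+ a i.

(* Polynomial functions are total functions on R^d; since the reference polytope
   has nonempty interior they are determined by their restriction to it. *)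
Definition poly_space (R : realType) (d : nat) (A : {fset mindex d}) :
    set ('rV[R]_d -> R) :=
  [set v | exists c : mindex d -> R,
     v = fun x => \sum_(a <- A) c a * monomial a x].

Record operators (R : realType) (d : nat) (E : polytope R d) := Operators {
  degree : nat;
  exponents : {fset mindex d};
  exponents_total : forall a : mindex d,
    (\sum_i a i <= degree)%N -> a \in exponents;
  Np : nat;
  Np_card : Np = #|` exponents|;
  poly_partial : forall (m : 'I_d) v,
    poly_space exponents v -> poly_space exponents (partial m v : 'rV[R]_d -> R);
  phi : 'I_Np -> 'rV[R]_d -> R;
  phi_poly : forall j, poly_space exponents (phi j);
  phi_basis : forall v, poly_space exponents v ->
    exists! c : 'cV[R]_Np, v = fun x => \sum_j c j 0 * phi j x;
  N : nat;
  N_ge : (Np <= N)%N;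
  node : 'I_N -> 'rV[R]_d;
  node_body : forall i, body E (node i);
  Nf : 'I_(nfacets E) -> nat;
  fnode : forall g, 'I_(Nf g) -> 'rV[R]_d;
  fnode_facet : forall g (i : 'I_(Nf g)), facet g (fnode i);
  W : 'M[R]_N;
  Wf : forall g, 'M[R]_(Nf g);
  D : 'I_d -> 'M[R]_Np;
  D_partial : forall m j,
    partial m (phi j) = (fun x => \sum_i D m i j * phi i x) :> ('rV[R]_d -> R);
  Kexponents : {fset mindex d};
  Kexponents_sub : (Kexponents `<=` exponents)%fset;
  Kcoef : mindex d -> R
}.

Arguments W {R d E} _.
Arguments Wf {R d E} _ g.
Arguments phi {R d E} _ j.
Arguments node {R d E} _ i.
Arguments Nf {R d E} _ g.
Arguments fnode {R d E} _ {g} i.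
Arguments D {R d E} _ m.

Section Operators.
Context (R : realType) (d : nat) (E : polytope R d) (B : operators E).

Definition ip (n : nat) (x : 'I_n -> 'rV[R]_d) (A : 'M[R]_n)
    (u v : 'rV[R]_d -> R) : R :=
  \sum_i \sum_j u (x i) * A i j * v (x j).

Definition Vmx : 'M[R]_(N B, Np B) := \matrix_(i, j) phi B j (node B i).
Definition Vf (g : 'I_(nfacets E)) : 'M[R]_(Nf B g, Np B) :=
  \matrix_(i, j) phi B j (fnode B i).
Definition Mmx : 'M[R]_(Np B) := Vmx^T *m W B *m Vmx.
Definition Pmx : 'M[R]_(Np B, N B) := invmx Mmx *m Vmx^T *m W B.
Definition Dalpha (a : mindex d) : 'M[R]_(Np B) := \prod_(m < d) D B m ^+ a m.
Definition Kmx : 'M[R]_(Np B) :=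
  \sum_(a <- Kexponents B)
    (Kcoef B a / fine (volume (body E)))
      *: ((Dalpha a)^T *m Mmx *m Dalpha a).
Definition Lmx (g : 'I_(nfacets E)) : 'M[R]_(Np B, Nf B g) :=
  invmx (Mmx + Kmx) *m (Vf g)^T *m Wf B g.

Definition discrete_divergence_theorem : Prop :=
  forall v : 'I_d -> 'rV[R]_d -> R,
    (forall m, poly_space (exponents B) (v m)) ->
    ip (node B) (W B) (fun=> 1)
       (fun x => \sum_m partial m (v m) x)
    = \sum_g ip (@fnode _ _ _ B g) (Wf B g) (fun=> 1)
       (fun x => \sum_m v m x * normal g 0 m).

End Operators.

(* [periodic] records which facets (element, local facet) are identified by
   periodic boundary conditions. *)
Record mesh (R : realType) (d : nat) (E : polytope R d) := Mesh {
  domain : set 'rV[R]_d;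
  nelem : nat;
  emap : 'I_nelem -> 'rV[R]_d -> 'rV[R]_d;
  mnormal : 'I_nelem * 'I_(nfacets E) -> 'rV[R]_d -> 'rV[R]_d;
  periodic : 'I_nelem * 'I_(nfacets E) -> 'I_nelem * 'I_(nfacets E) -> Prop;
  emap_smooth : forall k, smooth_near (body E) (emap k);
  emap_inj : forall k, set_inj (body E) (emap k);
  (* the library's jacobian acts on row vectors, hence is the transpose of the
     Jacobian matrix; the determinant is the same *)
  emap_det : forall k x, body E x -> 0 < \det ('J (emap k) x);
  domain_open : open domain;
  domain_cover : closure domain = \bigcup_k (emap k @` body E);
  elem_disjoint : forall k l, k != l ->
    (emap k @` body E)° `&` (emap l @` body E)° = set0;
  mnormal_outward : forall q, outward_unit_normal (emap q.1 @` body E)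
    (emap q.1 @` facet q.2) (emap q.1 @` facet_interior (@facet R d E) q.2)
    (mnormal q);
  periodic_sym : forall q r, periodic q r -> periodic r q;
  periodic_boundary : forall q r, periodic q r ->
    emap q.1 @` facet q.2 `<=` closure domain `\` domain
}.

Section Mesh.
Context (R : realType) (d : nat) (E : polytope R d) (B : operators E).
Context (Q : mesh E).

Definition face : Type := ('I_(nelem Q) * 'I_(nfacets E))%type.

Definition mfacet (q : face) : set 'rV[R]_d := emap q.1 @` facet q.2.

(* J_ij = d X_i / d x_j *)
Definition jacmx (k : 'I_(nelem Q)) (x : 'rV[R]_d) : 'M[R]_d := ('J (emap k) x)^T.
Definition jacdet (k : 'I_(nelem Q)) (x : 'rV[R]_d) : R := \det (jacmx k x).
Definition jacfacet (q : face) (x : 'rV[R]_d) : R :=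
  norm2 (jacdet q.1 x *: ((invmx (jacmx q.1 x))^T *m (normal q.2)^T))^T.

Definition Jmx (k : 'I_(nelem Q)) : 'M[R]_(N B) :=
  diag_mx (\row_i jacdet k (node B i)).
Definition Jf (q : face) : 'M[R]_(Nf B q.2) :=
  diag_mx (\row_i jacfacet q (fnode B i)).
Definition Mk (k : 'I_(nelem Q)) : 'M[R]_(Np B) :=
  (Vmx B)^T *m W B *m Jmx k *m Vmx B.

(* The closure puts back the edges that a non-periodic boundary facet shares
   with periodic ones. *)
Definition nonperiodic_boundary : set 'rV[R]_d :=
  closure ((closure (domain Q) `\` domain Q)
           `\` \bigcup_(q in [set q | exists r, periodic q r]) mfacet q).

Definition boundary_faces : {set face} :=
  [set q : face | `[< mfacet q `<=` nonperiodic_boundary >]]%SET.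
Definition interface_faces : {set face} := (~: boundary_faces)%SET.

Definition coincident (q r : face) : Prop := q != r /\ mfacet q = mfacet r.
Definition connected_faces (q r : face) : Prop := coincident q r \/ periodic q r.

(* The facet r is the translate by c of q, with c = 0 for an interior interface.
   Opposite orientation is only required in the periodic case. *)
Definition connected_by (q r : face) (c : 'rV[R]_d) : Prop :=
  (coincident q r /\ c = 0) \/
  [/\ periodic q r, mfacet r = [set x + c | x in mfacet q] &
      forall x, mfacet q x -> mnormal r (x + c) = - mnormal q x].

Definition conforming (tau : forall q : face, 'S_(Nf B q.2)) : Prop :=
  (forall q, q \in interface_faces ->
     exists! r, r \in interface_faces /\ connected_faces q r) /\
  (forall q r, q \in interface_faces -> r \in interface_faces ->
     connected_faces q r ->
     exists (c : 'rV[R]_d) (e : Nf B q.2 = Nf B r.2),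
       [/\ connected_by q r c,
           forall i, emap q.1 (fnode B i) + c
                     = emap r.1 (fnode B (cast_ord e (tau q i))) &
           Wf B r.2 *m Jf r
           = castmx (e, e) ((perm_mx (tau q))^T *m Wf B q.2 *m Jf q
                            *m perm_mx (tau q))]).

End Mesh.

(* F and Fstar are total functions of which only the values on states in Ups
   (and on unit vectors) are meaningful. *)
Record conservation_law (R : realType) (d : nat) := ConservationLaw {
  Neq : nat;
  Ups : set 'rV[R]_Neq;
  flux : 'I_d -> 'rV[R]_Neq -> 'rV[R]_Neq;
  numflux : 'rV[R]_Neq -> 'rV[R]_Neq -> 'rV[R]_d -> 'rV[R]_Neq
}.

Arguments Ups {R d} _ _.
Arguments flux {R d} _ m U.
Arguments numflux {R d} _ U V n.

Definition flux_antisymmetric (R : realType) (d : nat)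
    (L : conservation_law R d) : Prop :=
  forall (U V : 'rV[R]_(Neq L)) (n : 'rV[R]_d),
    Ups L U -> Ups L V -> norm2 n = 1 ->
    numflux L U V n = - numflux L V U (- n).

Section SemiDiscrete.
Context (R : realType) (d : nat) (E : polytope R d) (B : operators E).
Context (Q : mesh E) (L : conservation_law R d).

Definition coefficients : Type :=
  'I_(nelem Q) -> 'I_(Neq L) -> R -> 'cV[R]_(Np B).
(* U^+, given by its values at the facet nodes *)
Definition external_data : Type :=
  forall q : face Q, 'I_(Nf B q.2) -> R -> 'rV[R]_(Neq L).

Context (u : coefficients) (uplus : external_data).

Definition Uh (k : 'I_(nelem Q)) (x : 'rV[R]_d) (t : R) : 'rV[R]_(Neq L) :=
  \row_e \sum_i u k e t i 0 * phi B i x.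

Definition fvol (k : 'I_(nelem Q)) (m : 'I_d) (e : 'I_(Neq L)) (t : R) :
    'cV[R]_(N B) :=
  \col_i (\sum_n (jacdet k (node B i) * invmx (jacmx k (node B i)) m n)
                   *: flux L n (Uh k (node B i) t)) 0 e.

Definition fstar (q : face Q) (e : 'I_(Neq L)) (t : R) : 'cV[R]_(Nf B q.2) :=
  \col_i (jacfacet q (fnode B i) *:
            numflux L (Uh q.1 (fnode B i) t) (uplus i t)
                    (mnormal q (emap q.1 (fnode B i)))) 0 e.

(* the facet penalty  f* - sum_n nhat_n V P f^n *)
Definition fjump (q : face Q) (e : 'I_(Neq L)) (t : R) : 'cV[R]_(Nf B q.2) :=
  fstar q e t
  - \sum_n normal q.2 0 n *: (Vf B q.2 *m Pmx B *m fvol q.1 n e t).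

Definition FR_equation (k : 'I_(nelem Q)) (e : 'I_(Neq L)) (t : R) : Prop :=
  Pmx B *m Jmx B k *m Vmx B *m derive1 (u k e) t
  + \sum_m D B m *m Pmx B *m fvol k m e t
  + \sum_g Lmx B g *m fjump (k, g) e t = 0.

Definition DG_equation (k : 'I_(nelem Q)) (e : 'I_(Neq L)) (t : R) : Prop :=
  Mk B k *m derive1 (u k e) t
  + \sum_m Mmx B *m D B m *m Pmx B *m fvol k m e t
  + \sum_g (Vf B g)^T *m Wf B g *m fjump (k, g) e t = 0.

(* 1^T W J V u *)
Definition content (k : 'I_(nelem Q)) (e : 'I_(Neq L)) (t : R) : R :=
  ((const_mx 1 : 'cV[R]_(N B))^T *m W B *m Jmx B k *m Vmx B *m u k e t) 0 0.

(* 1^T W^(g) f* *)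
Definition outflow (q : face Q) (e : 'I_(Neq L)) (t : R) : R :=
  ((const_mx 1 : 'cV[R]_(Nf B q.2))^T *m Wf B q.2 *m fstar q e t) 0 0.

Definition interface_data (T : R) (tau : forall q : face Q, 'S_(Nf B q.2)) :
    Prop :=
  forall q r, q \in interface_faces Q -> r \in interface_faces Q ->
    connected_faces q r ->
    forall (e : Nf B q.2 = Nf B r.2) (i : 'I_(Nf B q.2)) (t : R), 0 < t < T ->
      uplus i t = Uh r.1 (fnode B (cast_ord e (tau q i))) t.

Definition locally_conservative (T : R) : Prop :=
  forall k e t, 0 < t < T ->
    derivable (content k e) t 1
    /\ derive1 (content k e) t + \sum_g outflow (k, g) e t = 0.

Definition globally_conservative (T : R) : Prop :=
  forall e t, 0 < t < T ->
    derivable (fun s => \sum_k content k e s) t 1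
    /\ derive1 (fun s => \sum_k content k e s) t
       + \sum_(q in boundary_faces Q) outflow q e t = 0.

End SemiDiscrete.

(* Main.v *)
Require Import Defs.
From mathcomp Require Import all_boot all_order all_algebra perm finmap.
From mathcomp Require Import all_classical all_reals all_analysis.
From mathcomp Require Import ring lra.

(** Local conservation comes from testing the method with the constant function.
    Let [c] be the coefficients of the function 1, so that [V c] and every
    [V^(g) c] are vectors of ones.  Multiplying the DG equation by [c^T] turns
    the mass term into the rate of change of the content and the volume term
    into a discrete integral of a divergence; the discrete divergence theorem
    cancels the latter against the interior traces in the facet penalties, and
    only the numerical fluxes survive ([local_balance]).  For FR one multiplies
    by [c^T (M + K)] instead, and needs [K c = 0].  Differentiating a nonconstant
    monomial until a constant is left shows that 1 is itself a partial
    derivative ([const_is_partial]), so [c = D^(m) b] for some [m] and [b], and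
    [K D^(m) = 0] gives the claim; if constants are all there is, [K = 0] by
    assumption.

    Global conservation is the sum of the local balances, provided that the
    outflows through the interfaces cancel.  Each interface facet has exactly one
    partner and being partners is symmetric, so it suffices that the outflows
    through two partners are opposite ([outflow_opp]).  The weight assumption and
    the antisymmetry of the flux reduce this to two facts: each side takes its
    external state from the very node at which the other side is evaluated, and
    the normals at matching nodes are opposite.

    For the first fact ([interface_node_back]), going to the partner and back
    permutes the nodes of a facet and moves each of their images by the same
    vector; summing over the nodes, that vector is zero, and injectivity of the
    element map identifies the nodes.

    The second fact is part of the periodic identification, but for two facets
    that coincide in space it has to be derived from the geometry
    ([coincident_normals]).  The facet of the polytope fills its hyperplane near
    each of its relative interior points ([facet_interior_flat]), so the normals
    of both sides are orthogonal to the image of that hyperplane under the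
    invertible Jacobian, hence equal up to sign.  If they were equal at a point
    in the relative interior of both facets, the two elements would lie on the
    same side and their interiors would meet.  Such points are dense in the
    facet, and continuity of the normals does the rest. *)

Import Order.TTheory GRing.Theory Num.Theory.
Import numFieldNormedType.Exports.

Set Implicit Arguments.
Unset Strict Implicit.
Unset Printing Implicit Defensive.

Local Open Scope classical_set_scope.
Local Open Scope ring_scope.

Local Notation ones n := (const_mx 1 : 'cV_n).

(** * Polynomials and their coefficients *)

(** Reduces a directional derivative to the one-variable calculus of powers and
    products. *)
Lemma is_derive_line (R : realType) (V W : normedModType R) (f : V -> W)
    (x v : V) (df : W) :
  is_derive (0 : R) 1 (fun h => f (h *: v + x)) df -> is_derive x v f df.
Proof.
have lineE : (fun h : R => h^-1 *: ((f \o shift x) (h *: v) - f x)) =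
    (fun h : R => h^-1 *: (((fun h => f (h *: v + x)) \o shift (0 : R)) (h *: 1)
       - (fun h => f (h *: v + x)) 0)).
  by apply/funext => h /=; rewrite addr0 scale0r add0r [h *: 1]mulr1.
by case=> dl <-; split; rewrite /derivable /derive lineE.
Qed.

Definition lower (d : nat) (m : 'I_d) (a : mindex d) : mindex d :=
  [ffun i => (a i - (i == m))%N].

Lemma is_derive_monomial (R : realType) (d : nat) (m : 'I_d) (a : mindex d)
    (x : 'rV[R]_d) :
  is_derive x (delta_mx 0 m) (@monomial R d a)
    ((a m)%:R * monomial (lower m a) x).
Proof.
apply: is_derive_line.
pose C := \prod_(i < d | i != m) x 0 i ^+ a i.
have -> : (fun h : R => monomial a (h *: delta_mx 0 m + x)) =
    C \*: ((id + cst (x 0 m)) ^+ a m : R -> R).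
  apply/funext => h /=; rewrite /monomial (bigD1 m) //= [LHS]mulrC exprfctE.
  congr (_ * _); last by rewrite !mxE !eqxx mulr1.
  apply: eq_bigr => i im; rewrite !mxE eqxx /= (negPf im).
  by rewrite mulr0 add0r.
apply: is_derive_eq; rewrite /monomial (bigD1 m) //= ffunE eqxx subn1.
rewrite (eq_bigr (fun i => x 0 i ^+ a i)); last first.
  by move=> i im; rewrite ffunE (negPf im) subn0.
by rewrite /GRing.scale /= -/C !fctE /= add0r addr0 mulr1 mulrC mulrA.
Qed.

Lemma poly_space_monomial (R : realType) (d : nat) (A : {fset mindex d}) a :
  a \in A -> poly_space A (@monomial R d a).
Proof.
move=> aA; exists (fun b => (b == a)%:R); apply/funext => x.
rewrite (bigD1_seq a) //= eqxx mul1r big1 ?addr0// => b /negPf ->.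
by rewrite mul0r.
Qed.

Lemma poly_spaceZ (R : realType) (d : nat) (A : {fset mindex d}) (k : R) v :
  poly_space A v -> poly_space A (fun x => k * v x).
Proof.
case=> c ->; exists (fun b => k * c b); apply/funext => x.
by rewrite mulr_sumr; apply: eq_bigr => b _; rewrite mulrA.
Qed.

Lemma poly_space_derivable (R : realType) (d : nat) (A : {fset mindex d})
    (v : 'rV[R]_d -> R) (m : 'I_d) (x : 'rV[R]_d) :
  poly_space A v -> derivable v x (delta_mx 0 m).
Proof.
case=> c ->.
have -> : (fun x => \sum_(a <- A) c a * monomial a x) =
    \sum_(a <- A) (c a \*: @monomial R d a).
  by apply/funext => y; rewrite fct_sumE.
elim/big_ind: _ => [|f g|a _]; first exact: derivable_cst.
  exact: derivableD.
by apply: derivableZ; have /@ex_derive := is_derive_monomial m a x.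
Qed.

(** Differentiate the monomial in a variable that it contains: either a constant
    is left, or a monomial of smaller degree, which again lies in the space and
    to which the argument applies. *)
Lemma const_is_partial (R : realType) (d : nat) (A : {fset mindex d})
    (A_partial : forall (m : 'I_d) v, poly_space A v ->
       poly_space A (partial m v : 'rV[R]_d -> R)) (a : mindex d) :
  poly_space A (@monomial R d a) -> (0 < \sum_i a i)%N ->
  exists m (v : 'rV[R]_d -> R), poly_space A v /\ partial m v = cst 1.
Proof.
move: {-1}(\sum_i a i)%N (erefl (\sum_i a i)%N) => s.
elim: s a => // s IH a sa Aa _.
have [m am] : exists m, (0 < a m)%N.
  apply: contrapT => /forallNP a0.
  by move: sa; rewrite big1// => i _; have := a0 i; case: (a i).
have ams : (a m)%:R != 0 :> R by rewrite pnatr_eq0 -lt0n.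
pose v : 'rV[R]_d -> R := fun x => (a m)%:R^-1 * monomial a x.
have Av : poly_space A v by exact: poly_spaceZ.
have Dv : partial m v = monomial (lower m a).
  apply/funext => x; rewrite /partial.
  have := is_deriveZ (a m)%:R^-1 (is_derive_monomial m a x).
  by move=> /@derive_val ->; rewrite /GRing.scale /= mulKf.
have sl : (\sum_i lower m a i)%N = s.
  move: sa; rewrite (bigD1 m) //= [X in _ -> X = _](bigD1 m) //=.
  rewrite ffunE eqxx subn1 => sa.
  rewrite (eq_bigr a) => [|i im]; last by rewrite ffunE (negPf im) subn0.
  by move: sa am; case: (a m) => //= n [].
case: s IH sa sl => [|s] IH sa sl; last first.
  by apply: (IH (lower m a)) => //; rewrite -Dv; exact: A_partial.
exists m, v; split => //; rewrite Dv; apply/funext => x.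
rewrite /monomial big1// => i _; move/eqP: sl.
by rewrite sum_nat_eq0 => /forallP/(_ i)/eqP ->; rewrite expr0.
Qed.

Lemma spd_unitmx (R : realType) n (A : 'M[R]_n) : spd A -> A \in unitmx.
Proof.
case=> A_sym A_pos; rewrite -row_free_unit -kermx_eq0.
apply: contraT => /rowV0Pn [v /sub_kermxP vA v0].
have := A_pos v^T; rewrite trmx_eq0 => /(_ v0).
by rewrite trmxK vA mul0mx mxE ltxx.
Qed.

Section Operators.
Context (R : realType) (d : nat) (E : polytope R d) (B : operators E).

Definition lincomb (c : 'cV[R]_(Np B)) : 'rV[R]_d -> R :=
  fun x => \sum_j c j 0 * phi B j x.

Lemma lincomb_poly c : poly_space (exponents B) (lincomb c).
Proof.
have [C phiE] := boolp.choice (@phi_poly _ _ _ B).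
exists (fun a => \sum_j c j 0 * C j a); apply/funext => x.
rewrite /lincomb; under eq_bigr do rewrite phiE mulr_sumr.
rewrite exchange_big /=; apply: eq_bigr => a _; rewrite mulr_suml.
by apply: eq_bigr => j _; rewrite mulrA.
Qed.

Lemma lincomb_inj : injective lincomb.
Proof.
move=> c c' cc'; have [b [_ bP]] := phi_basis (lincomb_poly c).
by rewrite -(bP c erefl) -(bP c' cc').
Qed.

Lemma partial_lincomb m c : partial m (lincomb c) = lincomb (D B m *m c).
Proof.
have -> : lincomb c = \sum_j (c j 0 \*: phi B j).
  by apply/funext => x; rewrite fct_sumE.
have dphi j x : derivable (phi B j) x (delta_mx 0 m).
  by apply: poly_space_derivable; exact: phi_poly.
apply/funext => x; rewrite /partial derive_sum; last first.
  by move=> j; exact: derivableZ.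
under eq_bigr => j _.
  rewrite deriveZ // -[X in _ *: X]/(partial m (phi B j) x) D_partial.
  rewrite /GRing.scale /= mulr_sumr; over.
rewrite exchange_big /=; apply: eq_bigr => i _; rewrite mxE mulr_suml.
by apply: eq_bigr => j _; rewrite mulrA [c _ _ * _]mulrC.
Qed.

(** The vector [c] with which the methods are tested.  Unless the space consists
    of constants only, it contains a nonconstant monomial, and then [c] lies in
    the range of a differentiation matrix: this is what makes [K c] vanish. *)
Lemma const_coefficients :
    (forall a : R, poly_space (exponents B) (cst a)) ->
  exists c : 'cV[R]_(Np B),
  [/\ Vmx B *m c = ones (N B), forall g, Vf B g *m c = ones (Nf B g) &
    Np B <> 1%N -> exists m (b : 'cV[R]_(Np B)), c = D B m *m b].
Proof.
move=> const_poly.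
have coefs v : poly_space (exponents B) v -> exists b, v = lincomb b.
  by move=> /phi_basis [b [-> _]]; exists b.
have [c c1] := coefs _ (const_poly 1).
exists c; split => [|g|Np1].
- by apply/colP => i; rewrite !mxE -[RHS]/(cst 1 (node B i)) c1;
    apply: eq_bigr => j _; rewrite mxE mulrC.
- by apply/colP => i; rewrite !mxE -[RHS]/(cst 1 (fnode B i)) c1;
    apply: eq_bigr => j _; rewrite mxE mulrC.
have [a aA a0] : exists2 a : mindex d, a \in exponents B & (0 < \sum_i a i)%N.
  apply: contrapT => allz; apply: Np1; rewrite Np_card.
  have -> : exponents B = [fset [ffun=> 0%N] : mindex d]%fset.
    apply/fsetP => a; rewrite inE; apply/idP/eqP => [aA|->]; last first.
      by apply: exponents_total; rewrite big1// => i _; rewrite ffunE.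
    apply/ffunP => i; rewrite ffunE; apply: contrapT => ai.
    apply: allz; exists a => //; rewrite (bigD1 i) //=.
    by move/eqP: ai; case: (a i).
  by rewrite cardfs1.
have [m [v [/coefs[b ->]]]] :=
  const_is_partial (@poly_partial _ _ _ B) (poly_space_monomial R aA) a0.
rewrite c1 partial_lincomb => /lincomb_inj <-.
by exists m, b.
Qed.

Lemma mass_spd : \rank (Vmx B) = Np B -> spd (W B) -> spd (Mmx B).
Proof.
move=> V_rank [W_sym W_pos]; split.
  by rewrite /Mmx !trmx_mul trmxK W_sym mulmxA.
move=> x x0; rewrite /Mmx.
have -> : x^T *m ((Vmx B)^T *m W B *m Vmx B) *m x
    = (Vmx B *m x)^T *m W B *m (Vmx B *m x) by rewrite trmx_mul !mulmxA.
apply: W_pos; apply: contraNneq x0 => Vx0.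
have /row_free_inj VT_inj : row_free (Vmx B)^T.
  by rewrite /row_free mxrank_tr V_rank.
rewrite -trmx_eq0; apply/eqP; apply: (VT_inj 1%N).
by rewrite mul0mx -trmx_mul Vx0 trmx0.
Qed.

Lemma Kmx_sym : (W B)^T = W B -> (Kmx B)^T = Kmx B.
Proof.
move=> W_sym; rewrite /Kmx; elim/big_ind: _ => [|X Y XT YT|a _].
- exact: trmx0.
- by rewrite linearD /= XT YT.
- by rewrite linearZ /= /Mmx !trmx_mul !trmxK W_sym !mulmxA.
Qed.

Lemma divergence_matrix (p : 'I_d -> 'cV[R]_(Np B)) :
    discrete_divergence_theorem B ->
  \sum_m (ones (N B))^T *m W B *m Vmx B *m (D B m *m p m)
  = \sum_g (ones (Nf B g))^T *m Wf B g
       *m \sum_n normal g 0 n *: (Vf B g *m p n).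
Proof.
move=> ddt; have := ddt (fun m => lincomb (p m)) (fun m => lincomb_poly (p m)).
have ipE n (x : 'I_n -> 'rV[R]_d) (A : 'M[R]_n) v :
    ip x A (fun=> 1) v = ((ones n)^T *m A *m (\col_i v (x i))) 0 0.
  rewrite /ip mxE exchange_big /=; apply: eq_bigr => j _.
  rewrite !mxE mulr_suml; apply: eq_bigr => i _.
  by rewrite !mxE.
have VE c : Vmx B *m c = \col_i lincomb c (node B i).
  by apply/colP => i; rewrite !mxE; apply: eq_bigr => j _; rewrite mxE mulrC.
have VfE g c : Vf B g *m c = \col_i lincomb c (fnode B i).
  by apply/colP => i; rewrite !mxE; apply: eq_bigr => j _; rewrite mxE mulrC.
rewrite ipE; under [RHS]eq_bigr do rewrite ipE.
rewrite -summxE => ddtp.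
have scalar_inj (x y : 'M[R]_1) : x 0 0 = y 0 0 -> x = y.
  by move=> xy; apply/matrixP => i k; rewrite !ord1.
rewrite (eq_bigr (fun m => (ones (N B))^T *m W B *m (Vmx B *m (D B m *m p m))));
  last by move=> m _; rewrite !mulmxA.
rewrite -mulmx_sumr; apply: scalar_inj.
transitivity (((ones (N B))^T *m W B
    *m \col_i \sum_m partial m (lincomb (p m)) (node B i)) 0 0).
  congr ((_ *m _) 0 0); apply/colP => i; rewrite summxE mxE.
  by apply: eq_bigr => m _; rewrite VE mxE partial_lincomb.
rewrite ddtp; apply: (congr1 (fun x : 'M[R]_1 => x 0 0)).
apply: eq_bigr => g _.
congr (_ *m _); apply/colP => i; rewrite mxE summxE.
by apply: eq_bigr => n _; rewrite VfE !mxE mulrC.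
Qed.

End Operators.

(** * Local conservation *)

Section Local.
Context (R : realType) (d : nat) (E : polytope R d) (B : operators E).
Context (Q : mesh E) (L : conservation_law R d).
Context (u : coefficients B Q L) (uplus : external_data B Q L).
Context (ddt : discrete_divergence_theorem B).

(** Common end of the arguments for DG and FR: the volume term cancels the
    interior part of the facet penalties. *)
Lemma local_balance k e t :
  (ones (N B))^T *m W B *m Jmx B k *m Vmx B *m derive1 (u k e) t
  + \sum_m (ones (N B))^T *m W B *m Vmx B *m (D B m *m (Pmx B *m fvol u k m e t))
  + \sum_g (ones (Nf B g))^T *m Wf B g *m fjump u uplus (k, g) e t = 0 ->
  ((ones (N B))^T *m W B *m Jmx B k *m Vmx B *m derive1 (u k e) t) 0 0
  + \sum_g outflow u uplus (k, g) e t = 0.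
Proof.
rewrite (divergence_matrix (fun m => Pmx B *m fvol u k m e t)) // => bal.
have addE (x y : 'M[R]_1) : x 0 0 + y 0 0 = (x + y) 0 0 by rewrite mxE.
rewrite /outflow -summxE addE.
have := congr1 (fun x : 'M[R]_1 => x 0 0) bal; rewrite [RHS]mxE => <-.
apply: (congr1 (fun x : 'M[R]_1 => x 0 0)).
rewrite -addrA -big_split /=; congr (_ + _); apply: eq_bigr => g _.
rewrite -mulmxDr; congr (_ *m _); rewrite /fjump /=.
rewrite addrC -[LHS]addr0 -addrA; congr (_ + _); apply/esym/eqP.
rewrite addrC subr_eq0; apply/eqP.
by apply: eq_bigr => n _; rewrite mulmxA.
Qed.

Lemma DG_balance k e t (c : 'cV[R]_(Np B)) :
    Vmx B *m c = ones (N B) -> (forall g, Vf B g *m c = ones (Nf B g)) ->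
  DG_equation u uplus k e t ->
  ((ones (N B))^T *m W B *m Jmx B k *m Vmx B *m derive1 (u k e) t) 0 0
  + \sum_g outflow u uplus (k, g) e t = 0.
Proof.
move=> Vc Vfc eqn; apply: local_balance.
have := congr1 (mulmx c^T) eqn; rewrite mulmx0 => eqn0.
apply: (etrans _ eqn0).
rewrite !mulmxDr !mulmx_sumr; congr (_ + _ + _).
- by rewrite /Mk -Vc trmx_mul !mulmxA.
- by apply: eq_bigr => m _; rewrite -Vc trmx_mul /Mmx !mulmxA.
- by apply: eq_bigr => g _; rewrite -Vfc trmx_mul !mulmxA.
Qed.

(** Testing with [c^T (M + K)]: the factor [M + K] cancels the inverse in the
    lifting matrices, and by symmetry of [K] the test vector is just [c^T M], so
    that [M P = V^T W] turns the FR equation into the tested DG equation. *)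
Lemma FR_balance k e t (c : 'cV[R]_(Np B)) :
    (W B)^T = W B -> Mmx B \in unitmx -> Mmx B + Kmx B \in unitmx ->
    Kmx B *m c = 0 ->
    Vmx B *m c = ones (N B) -> (forall g, Vf B g *m c = ones (Nf B g)) ->
  FR_equation u uplus k e t ->
  ((ones (N B))^T *m W B *m Jmx B k *m Vmx B *m derive1 (u k e) t) 0 0
  + \sum_g outflow u uplus (k, g) e t = 0.
Proof.
move=> W_sym M_unit MK_unit Kc Vc Vfc eqn; apply: local_balance.
have cMK : c^T *m (Mmx B + Kmx B) = c^T *m Mmx B.
  by rewrite mulmxDr -(Kmx_sym W_sym) -[X in _ + X]trmx_mul Kc trmx0 addr0.
have MP : Mmx B *m Pmx B = (Vmx B)^T *m W B.
  by rewrite /Pmx !mulmxA mulmxV// mul1mx.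
have cM : c^T *m Mmx B = (ones (N B))^T *m W B *m Vmx B.
  by rewrite /Mmx -Vc trmx_mul !mulmxA.
have cMP : c^T *m Mmx B *m Pmx B = (ones (N B))^T *m W B.
  by rewrite -mulmxA MP -Vc trmx_mul !mulmxA.
have [l [lP lV lL]] : exists l : 'rV[R]_(Np B),
    [/\ l *m Pmx B = (ones (N B))^T *m W B, l = (ones (N B))^T *m W B *m Vmx B &
      forall g, l *m Lmx B g = (ones (Nf B g))^T *m Wf B g].
  exists (c^T *m (Mmx B + Kmx B)); split=> [||g]; rewrite ?cMK //.
  rewrite -cMK /Lmx !mulmxA; congr (_ *m _).
  by rewrite -[c^T *m _ *m _]mulmxA mulmxV// mulmx1 -Vfc trmx_mul.
have := congr1 (mulmx l) eqn; rewrite mulmx0 => eqn0.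
apply: (etrans _ eqn0).
rewrite !mulmxDr !mulmx_sumr; congr (_ + _ + _).
- by move: (Pmx B) lP => P lP; rewrite !mulmxA lP.
- by apply: eq_bigr => m _; rewrite -lV; move: (Pmx B) => P; rewrite !mulmxA.
- by apply: eq_bigr => g _; rewrite mulmxA lL.
Qed.

Lemma content_derive k e t : derivable (u k e) t 1 ->
  derivable (Defs.content u k e) t 1 /\
  derive1 (Defs.content u k e) t
  = ((ones (N B))^T *m W B *m Jmx B k *m Vmx B *m derive1 (u k e) t) 0 0.
Proof.
set l := (ones (N B))^T *m W B *m Jmx B k *m Vmx B => du.
have cE : Defs.content u k e = \sum_j (l 0 j \*: (fun s => u k e s j 0)).
  by apply/funext => s; rewrite /Defs.content -/l mxE fct_sumE.
have duj j : derivable (fun s => u k e s j 0) t 1 by move/derivable_mxP: du.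
split.
  by rewrite cE; apply: derivable_sum => j; exact: derivableZ.
rewrite !derive1E cE derive_sum; last by move=> j; exact: derivableZ.
rewrite mxE derive_mx//; apply: eq_bigr => j _.
by rewrite deriveZ // [X in _ * X]mxE.
Qed.

End Local.

(** * Euclidean geometry of hyperplanes *)

Section EuclideanProduct.
Context (R : realType) (d : nat).
Implicit Types u v w : 'rV[R]_d.

Lemma dotvE u v : dotv u v = \sum_i u 0 i * v 0 i.
Proof. by rewrite /dotv mxE; apply: eq_bigr => i _; rewrite mxE. Qed.

Lemma dotvDr u v w : dotv u (v + w) = dotv u v + dotv u w.
Proof. by rewrite /dotv linearD mulmxDr mxE. Qed.

Lemma dotvDl u v w : dotv (u + v) w = dotv u w + dotv v w.
Proof. by rewrite /dotv mulmxDl mxE. Qed.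

Lemma dotvZr u v (k : R) : dotv u (k *: v) = k * dotv u v.
Proof. by rewrite /dotv linearZ -scalemxAr mxE. Qed.

Lemma dotvZl u v (k : R) : dotv (k *: u) v = k * dotv u v.
Proof. by rewrite /dotv -scalemxAl mxE. Qed.

Lemma dotvBr u v w : dotv u (v - w) = dotv u v - dotv u w.
Proof. by rewrite /dotv linearB mulmxBr !mxE. Qed.

Lemma dotv_mulmx u v (A : 'M[R]_d) : dotv u (v *m A) = dotv (u *m A^T) v.
Proof. by rewrite /dotv trmx_mul mulmxA. Qed.

Lemma dotvv_ge0 u : 0 <= dotv u u.
Proof. by rewrite dotvE; apply: sumr_ge0 => i _; rewrite -expr2 sqr_ge0. Qed.

Lemma dotvv_eq0 u : dotv u u = 0 -> u = 0.
Proof.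
rewrite dotvE => /eqP; rewrite psumr_eq0 => [|i _]; last first.
  by rewrite -expr2 sqr_ge0.
move=> /allP u0; apply/rowP => i; apply/eqP; rewrite mxE.
by have := u0 i; rewrite mem_index_enum mulf_eq0 orbb => /(_ isT).
Qed.

Lemma norm2_dotv u : norm2 u = 1 -> dotv u u = 1.
Proof.
by move=> /(congr1 (fun x => x ^+ 2)); rewrite sqr_sqrtr ?dotvv_ge0// expr1n.
Qed.

Lemma dotv_continuous u : continuous (dotv u : 'rV[R]_d -> R).
Proof.
have -> : dotv u = fun v => \sum_i u 0 i * v 0 i.
  by apply/funext => v; rewrite dotvE.
apply: continuous_big => [|i _]; first exact: add_continuous.
move=> v; apply: (@cvgM _ _ _ (nbhs_filter v) (cst (u 0 i)) (fun v => v 0 i)).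
  exact: cvg_cst.
exact: coord_continuous.
Qed.

Lemma norm2N u : norm2 (- u) = norm2 u.
Proof. by rewrite /norm2 /dotv linearN /= mulNmx mulmxN opprK. Qed.

(** A vector orthogonal to the hyperplane with unit normal [n] is a multiple of
    [n]: its component orthogonal to [n] lies in the hyperplane, hence is
    orthogonal to itself. *)
Lemma orthogonal_hyperplane (n w : 'rV[R]_d) : norm2 n = 1 ->
  (forall h, dotv n h = 0 -> dotv w h = 0) -> w = dotv n w *: n.
Proof.
move=> /norm2_dotv n1 wP; apply/eqP; rewrite -subr_eq0; apply/eqP.
set h := w - _.
have nh : dotv n h = 0 by rewrite dotvBr dotvZr n1 mulr1 subrr.
apply: dotvv_eq0; have := wP _ nh.
suff -> : dotv w h = dotv h h + dotv n w * dotv n h.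
  by rewrite nh mulr0 addr0.
by rewrite -dotvZl -dotvDl subrK.
Qed.

(** Both [n1] and [n2] are orthogonal to the image of the hyperplane under [A],
    so [n1 A^T] and [n2 A^T] are multiples of [n]. *)
Lemma unit_normals_pm (n n1 n2 : 'rV[R]_d) (A : 'M[R]_d) :
    A \in unitmx -> norm2 n = 1 -> norm2 n1 = 1 -> norm2 n2 = 1 ->
    (forall h, dotv n h = 0 -> dotv n1 (h *m A) = 0) ->
    (forall h, dotv n h = 0 -> dotv n2 (h *m A) = 0) ->
  n2 = n1 \/ n2 = - n1.
Proof.
move=> A_unit n_unit n1_unit n2_unit n1A n2A.
pose w := n *m invmx A^T.
have colinear m : (forall h, dotv n h = 0 -> dotv m (h *m A) = 0) ->
    exists k, m = k *: w.
  move=> mA; exists (dotv n (m *m A^T)); rewrite /w scalemxAl.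
  rewrite -orthogonal_hyperplane ?mulmxK ?unitmx_tr // => h nh.
  by rewrite -dotv_mulmx mA.
have [[a aE] [b bE]] := (colinear _ n1A, colinear _ n2A).
have := norm2_dotv n1_unit; have := norm2_dotv n2_unit.
rewrite aE bE !dotvZl !dotvZr !mulrA -!expr2 => b1 a1.
have w0 : dotv w w != 0.
  by apply: contra_eq_neq a1 => ->; rewrite mulr0 eq_sym oner_eq0.
move: b1; rewrite -a1 => /(mulIf w0) /eqP; rewrite eqf_sqr.
by case/orP => /eqP ->; [left|right; rewrite scaleNr].
Qed.

End EuclideanProduct.

(** Off the boundary, [S] agrees with its interior, so both cut the same part out
    of [A], and this part is relatively open and closed. *)
Lemma connected_interior (T : topologicalType) (S A : set T) :
    closed S -> connected A -> A `&` (S `\` S°) = set0 ->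
  A `&` S° !=set0 -> A `<=` S°.
Proof.
move=> S_closed A_conn A_bd A_int; apply/setIidPl.
apply: A_conn => //; first by exists S°; first exact: open_interior.
exists S => //; apply/seteqP; split => x [Ax Sx]; split => //.
  exact: interior_subset.
apply: contrapT => Sx'; have : (A `&` (S `\` S°)) x by [].
by rewrite A_bd.
Qed.

Lemma affine_path_connected (R : realType) (V : normedModType R) (a b : V) :
  connected ((fun t : R => a + t *: b) @` `[0, 1]%classic).
Proof.
apply: connected_continuous_connected; first exact: segment_connected.
apply: continuous_subspaceT => t.
by apply: cvgD; [exact: cvg_cst|apply: cvgZr_tmp; exact: cvg_id].
Qed.

(** * Facets of a polytope are relatively open in their hyperplanes *)

Lemma cvg_line (R : realType) (V : normedModType R) (a b : V) :
  (fun t : R => a + t *: b) @ (0 : R) --> a.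
Proof.
rewrite -[X in _ --> X]addr0 -(scale0r b).
by apply: cvgD; [exact: cvg_cst|apply: cvgZr_tmp; exact: cvg_id].
Qed.

Section FlatFacets.
Context (R : realType) (d : nat) (E : polytope R d).

Lemma body_closed : closed (body E).
Proof. by rewrite body_regular; exact: closed_closure. Qed.

Lemma facet_closed g : closed (facet (p:=E) g).
Proof. by rewrite facet_closure; exact: closed_closure. Qed.

Lemma facet_body g x : facet (p:=E) g x -> body E x.
Proof.
move=> gx; suff [] : (body E `\` (body E)°) x by [].
by rewrite body_boundary; exists g.
Qed.

Lemma normal_unit g : norm2 (normal (p:=E) g) = 1.
Proof.
by have [_ n1 _ _] := facet_normal g; have [x /n1] := facet_nonempty g.
Qed.

(** The other facets are closed, so they keep away from a relative interior point
    of [g]. *)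
Lemma facet_interior_near g z : facet_interior (@facet R d E) g z ->
  \forall y \near z, (body E `\` (body E)°) y -> facet g y.
Proof.
case=> gz ngz.
have : \forall y \near z, forall h, h != g -> ~ facet h y.
  apply: (filter_forall (nbhs_filter z)) => h; have [->|hg] := eqVneq h g.
    exact: nearW.
  near=> y => _; near: y.
  apply: open_nbhs_nbhs; split; last exact: ngz.
  exact/closed_openC/facet_closed.
apply: filterS => y yP; rewrite body_boundary => -[h _ hy].
have [<-//|hg] := eqVneq h g.
by case: (yP h hg).
Unshelve. all: by end_near. Qed.

Lemma near_at_right_affine (a b : 'rV[R]_d) (U : set 'rV[R]_d) :
  nbhs a U -> \forall k \near (0 : R)^'+, U (a + k *: b).
Proof.
by move=> aU; have lim := cvg_at_right_filter (@cvg_line _ _ a b); exact: lim.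
Qed.

(** Near a relative interior point [z] the boundary of the body lies in the
    hyperplane of [g].  A segment that stays on one side of this hyperplane thus
    cannot leave or enter the body: moving from [z] along the inward or outward
    normal and then parallel to the hyperplane, one stays inside, respectively
    outside.  Points [z + t h] of the hyperplane are limits of both kinds of
    points, so they are boundary points, and those belong to [g]. *)
Lemma facet_interior_flat g z h :
    facet_interior (@facet R d E) g z -> dotv (normal g) h = 0 ->
  \forall t \near (0 : R), facet g (z + t *: h).
Proof.
move=> gz nh; set n := normal g.
have n1 : dotv n n = 1 by apply: norm2_dotv; exact: normal_unit.
have /nbhs_ballP [e /= e0 eP] := facet_interior_near gz.
have [s [s0 sn [inn out]]] : exists s : R, [/\ 0 < s, s * `|n| < e / 2 &
    (body E)° (z - s *: n) /\ ~ body E (z + s *: n)].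
  have [_ _ _ /(_ z gz) side] := facet_normal g.
  apply: (@filter_ex _ (0 : R)^'+); near=> s; split; last by near: s.
    by [].
  rewrite (@le_lt_trans _ _ (s * (`|n| + 1)))//.
    by rewrite ler_pM2l // lerDl.
  rewrite -ltr_pdivlMr; last by rewrite ltr_wpDl.
  near: s; apply: nbhs_right_lt; by rewrite !divr_gt0.
near=> t.
have th : `|t *: h| < e / 2.
  rewrite normrZ (@le_lt_trans _ _ (`|t| * (`|h| + 1)))//.
    by rewrite ler_wpM2l // lerDl.
  rewrite -ltr_pdivlMr; last by rewrite ltr_wpDl.
  near: t; apply: (@nbhs0_lt _ R^o); by rewrite !divr_gt0.
(* For [c = 1] and [c = -1]: the straight path from [z + c s n], at [a = 0],
   to [z + t h + c b n], at [a = 1]. *)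
pose p c b (a : R) := (z + (c * s) *: n) + a *: (t *: h + (c * (b - s)) *: n).
have pE c b a : p c b a - z = a *: (t *: h) + (c * ((1 - a) * s + a * b)) *: n.
  rewrite /p; apply/rowP => i; rewrite !mxE; ring.
(* The component of [p c b a - z] along [n] is [c] times a convex combination
   of [s] and [b], hence not zero. *)
have nobd c b a : `|c| = 1 -> 0 < b <= s -> 0 <= a <= 1 ->
    ~ (body E `\` (body E)°) (p c b a).
  move=> c1 /andP[b0 bs] /andP[a0 a1] bd.
  have k0 : 0 < (1 - a) * s + a * b.
    have [->|a_neq1] := eqVneq a 1; first by rewrite subrr mul0r add0r mul1r.
    rewrite ltr_pwDl ?mulr_ge0 ?(ltW b0)// mulr_gt0// subr_gt0.
    by rewrite lt_neqAle a_neq1.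
  have ks : (1 - a) * s + a * b <= s by nra.
  have gp : facet g (p c b a).
    apply: eP => //; rewrite -ball_normE /ball_ /= distrC pE.
    apply: (le_lt_trans (ler_normD _ _)); rewrite [X in _ + X]normrZ normrM c1.
    rewrite mul1r (gtr0_norm k0) normrZ (ger0_norm a0) (splitr e) ltr_leD//.
      by apply: le_lt_trans th; rewrite ler_piMl.
    by apply: ltW; apply: le_lt_trans sn; rewrite ler_wpM2r.
  have := facet_flat gp gz.1; rewrite pE dotvDr !dotvZr nh n1 !mulr0 add0r mulr1.
  move/eqP; rewrite mulf_eq0 (gt_eqF k0) orbF => /eqP c0.
  by move: c1; rewrite c0 normr0 => /eqP; rewrite eq_sym oner_eq0.
have side c b : `|c| = 1 -> 0 < b <= s ->
    (body E)° (p c b 0) \/ (body E)° (p c b 1) ->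
    (body E)° (p c b 0) /\ (body E)° (p c b 1).
  move=> c1 bs pc.
  have sub : p c b @` `[0, 1]%classic `<=` (body E)°.
    apply: (connected_interior body_closed).
    - exact: affine_path_connected.
    - rewrite -subset0 => _ [[a /= a01 <-] bd].
      by apply: (nobd c b a c1 bs _ bd); move: a01; rewrite in_itv.
    - case: pc => pc; [exists (p c b 0)|exists (p c b 1)]; split => //.
        by exists 0 => //=; rewrite in_itv /= lexx ler01.
      by exists 1 => //=; rewrite in_itv /= lexx ler01.
  by split; apply: sub; [exists 0|exists 1] => //=; rewrite in_itv /= lexx ler01.
have p0 c b : p c b 0 = z + (c * s) *: n by rewrite /p scale0r addr0.
have p1 c b : p c b 1 = z + t *: h + (b *: (c *: n)).
  rewrite /p; apply/rowP => i; rewrite !mxE; ring.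
have inn' b : 0 < b <= s -> (body E)° (z + t *: h + b *: ((- 1) *: n)).
  move=> bs; rewrite -p1; apply: (side (-1) b _ bs _).2.
    by rewrite normrN1.
  by left; rewrite p0 mulN1r scaleNr.
have out' b : 0 < b <= s -> ~ body E (z + t *: h + b *: (1 *: n)).
  move=> bs; rewrite -p1 => p1b; apply: out.
  apply: interior_subset; rewrite -[s]mul1r -(p0 1 b).
  have b1 : `|1| = 1 :> R by rewrite normr1.
  apply: (side 1 b b1 bs _).1; right; apply: contrapT => p1i.
  by apply: (nobd 1 b 1 b1 bs); rewrite ?lexx ?ler01.
have b_small : \forall b \near (0 : R)^'+, 0 < b <= s.
  by near=> b; apply/andP; split => //; near: b; exact: nbhs_right_le.
have zt_body : body E (z + t *: h).
  apply: contrapT => zt_out.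
  have /(near_at_right_affine ((-1) *: n)) b_out : nbhs (z + t *: h) (~` body E).
    by apply: open_nbhs_nbhs; split => //; exact/closed_openC/body_closed.
  have [b [bs]] := @filter_ex _ _ _ _ (filterI b_small b_out).
  by apply; apply: interior_subset; exact: inn'.
apply: (eP (z + t *: h)).
  rewrite -ball_normE /ball_ /= opprD addNKr normrN.
  by apply: (lt_trans th); rewrite ltr_pdivrMr// ltr_pMr// ltr1n.
split=> // zt_int.
have b_in := near_at_right_affine (1 *: n) zt_int.
have [b [bs bb]] := @filter_ex _ _ _ _ (filterI b_small b_in).
exact: (out' b bs).
Unshelve. all: by end_near. Qed.

End FlatFacets.

(** * Normals of coincident facets *)

(** The difference quotients of [X] along [h] are eventually secants of [G], and
    [n] is nearly orthogonal to these. *)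
Lemma tangent_derive (R : realType) (d : nat) (X : 'rV[R]_d -> 'rV[R]_d)
    (z h n : 'rV[R]_d) (G : set 'rV[R]_d) :
    differentiable X z ->
    (forall e : R, 0 < e ->
       \forall y \near X z, G y -> `|dotv n (y - X z)| <= e * `|y - X z|) ->
    (\forall t \near (0 : R), G (X (z + t *: h))) ->
  dotv n ('D_h X z) = 0.
Proof.
move=> dX tangent Gt.
pose q (t : R) := t^-1 *: (X (t *: h + z) - X z).
have q_cvg : q @ (0 : R)^' --> 'D_h X z by exact: diff_derivable.
have lt_eps e : 0 < e -> `|dotv n ('D_h X z)| <= e * `|'D_h X z|.
  move=> e0.
  have X_cvg : (fun t : R => X (z + t *: h)) @ (0 : R) --> X z.
    apply: (@cvg_comp _ _ _ (fun t : R => z + t *: h) X _ (nbhs z)).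
      exact: cvg_line.
    by have X_cont := differentiable_continuous dX; exact: X_cont.
  have q_le : \forall t \near (0 : R)^', `|dotv n (q t)| <= e * `|q t|.
    near=> t.
    have : `|dotv n (X (z + t *: h) - X z)| <= e * `|X (z + t *: h) - X z|.
      have : G (X (z + t *: h)).
        by near: t; exact: nbhs_dnbhs.
      near: t; apply: nbhs_dnbhs; exact: X_cvg (tangent e e0).
    rewrite /q addrC [t *: h + z]addrC addrC dotvZr normrM normrZ mulrCA.
    by apply: ler_wpM2l.
  have dot_cvg : (fun t => `|dotv n (q t)|) @ (0 : R)^' --> `|dotv n ('D_h X z)|.
    apply: cvg_norm.
    apply: (@cvg_comp _ _ _ q (dotv n) _ (nbhs ('D_h X z))) => //.
    exact: dotv_continuous.
  have norm_cvg : (fun t => e * `|q t|) @ (0 : R)^' --> e * `|'D_h X z|.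
    by apply: cvgM; [exact: cvg_cst|exact: cvg_norm].
  rewrite -(cvg_lim _ dot_cvg)// -(cvg_lim _ norm_cvg)//.
  apply: ler_lim => //; first by apply/cvg_ex; eexists; exact: dot_cvg.
  by apply/cvg_ex; eexists; exact: norm_cvg.
apply/eqP; rewrite -normr_le0 leNgt; apply/negP => pos.
have den : 0 < `|'D_h X z| + 1 by rewrite ltr_wpDl.
have := lt_eps (`|dotv n ('D_h X z)| / (`|'D_h X z| + 1)) (divr_gt0 pos den).
apply/negP; rewrite -ltNge mulrAC ltr_pdivrMr// ltr_pM2l//.
by rewrite ltrDl.
Unshelve. all: by end_near. Qed.

Section CoincidentFacets.
Context (R : realType) (d : nat) (E : polytope R d) (Q : mesh E).

Definition mfacet_interior (q : face Q) : set 'rV[R]_d :=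
  emap q.1 @` facet_interior (@facet R d E) q.2.

Lemma emap_differentiable (k : 'I_(nelem Q)) z :
  body E z -> differentiable (emap k) z.
Proof.
by move=> zE; have [U [_ /(_ z zE) Uz /(_ [::] z Uz)]] := emap_smooth k.
Qed.

Lemma emap_continuous (k : 'I_(nelem Q)) z :
  body E z -> {for z, continuous (emap k)}.
Proof. by move=> zE; exact/differentiable_continuous/emap_differentiable. Qed.

Lemma mnormal_unit (q : face Q) x : mfacet q x -> norm2 (mnormal q x) = 1.
Proof. by move=> qx; have [_ -> //] := mnormal_outward q. Qed.

Lemma mnormal_tangent (q r : face Q) z h : mfacet q = mfacet r ->
    facet_interior (@facet R d E) q.2 z -> dotv (normal q.2) h = 0 ->
  dotv (mnormal r (emap q.1 z)) (h *m 'J (emap q.1) z) = 0.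
Proof.
move=> qr zq nh; have zb := facet_body zq.1.
rewrite -deriveEjacobian; last exact: emap_differentiable.
have rx : mfacet r (emap q.1 z) by rewrite -qr; exists z => //; exact: zq.1.
have [_ _ /(_ _ rx) tangent _] := mnormal_outward r.
apply: (tangent_derive (emap_differentiable _ zb) tangent).
have := facet_interior_flat zq nh; apply: filterS => t zt.
by rewrite -/(mfacet r) -qr; exists (z + t *: h).
Qed.

Lemma mfacet_interior_pm (q r : face Q) x : mfacet q = mfacet r ->
    mfacet_interior q x ->
  mnormal r x = mnormal q x \/ mnormal r x = - mnormal q x.
Proof.
move=> qr [z zq <-].
have qx : mfacet q (emap q.1 z) by exists z => //; exact: zq.1.
apply: (@unit_normals_pm _ _ (normal q.2) _ _ ('J (emap q.1) z)).
- rewrite unitmxE unitfE gt_eqF //; apply: emap_det; exact: facet_body zq.1.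
- exact: normal_unit.
- exact: mnormal_unit.
- by apply: mnormal_unit; rewrite -qr.
- by move=> h; exact: mnormal_tangent.
- by move=> h; exact: mnormal_tangent.
Qed.

(** Equal normals would put the points [x - s n] in the interiors of two distinct
    elements.  Within a single element, injectivity of its map excludes a common
    relative interior point of two facets. *)
Lemma mfacet_interiors_opp (q r : face Q) x : coincident q r ->
  mfacet_interior q x -> mfacet_interior r x -> mnormal r x = - mnormal q x.
Proof.
move=> [q_neq_r qr] qx rx; have [nE|//] := mfacet_interior_pm qr qx.
have [kl|kl] := eqVneq q.1 r.1.
  exfalso; case: q r q_neq_r qr qx rx kl {nE} => [k g] [l h] /= + _ + + kl.
  rewrite -{}kl => gh [z zg <-] [z' zh] /(emap_inj _ _) z'z.
  have zz' : z' = z.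
    by apply: z'z; rewrite inE; apply: facet_body; [exact: zh.1|exact: zg.1].
  apply: (zg.2 h); last by rewrite -zz'; exact: zh.1.
  by apply: contraNneq gh => ->.
have [_ _ _ /(_ x qx) q_side] := mnormal_outward q.
have [_ _ _ /(_ x rx) r_side] := mnormal_outward r.
have [s [[qs _]]] := @filter_ex _ _ _ _ (filterI q_side r_side).
rewrite nE => -[rs _]; exfalso.
by have := elem_disjoint kl; rewrite -subset0 => /(_ _ (conj qs rs)).
Qed.

Lemma mfacet_interior_dense (q : face Q) x U : mfacet q x -> nbhs x U ->
  mfacet_interior q `&` U !=set0.
Proof.
move=> [z zq <-] xU; have zc : closure (facet_interior (@facet R d E) q.2) z.
  by rewrite -facet_closure.
have [z' [z'q Uz']] := zc _ (emap_continuous (facet_body zq) xU).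
by exists (emap q.1 z'); split => //; exists z'.
Qed.

(** What is missing from the facet is the image of a compact set, hence closed. *)
Lemma mfacet_interior_relatively_open (q : face Q) x : mfacet_interior q x ->
  \forall y \near x, mfacet q y -> mfacet_interior q y.
Proof.
move=> [z zq <-].
pose C := facet q.2 `&` \bigcup_(h in [set h | h != q.2]) facet (p:=E) h.
have C_compact : compact (emap q.1 @` C).
  apply: continuous_compact.
    apply: continuous_in_subspaceT => y; rewrite inE => -[qy _].
    exact: emap_continuous (facet_body qy).
  apply: (subclosed_compact _ (@body_compact _ _ E)) => [|y [/facet_body //]].
  apply: closedI; first exact: facet_closed.
  by apply: closed_bigcup => [|h _]; [exact: finite_finset|exact: facet_closed].
have C_closed : closed (emap q.1 @` C).
  by apply: compact_closed => //; exact: norm_hausdorff.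
have xC : ~ (emap q.1 @` C) (emap q.1 z).
  move=> [y [qy [h /= hq hy]] /(emap_inj _ _) yz].
  have zy : y = z.
    by apply: yz; rewrite inE; apply: facet_body; [exact: qy|exact: zq.1].
  by apply: (zq.2 h hq); rewrite -zy.
have : nbhs (emap q.1 z) (~` (emap q.1 @` C)).
  by apply: open_nbhs_nbhs; split => //; exact: closed_openC.
apply: filterS => y yC [w qw wy]; exists w => //; split => // h hq hw.
by apply: yC; exists w => //; split => //; exists h.
Qed.

(** The common relative interior is dense, as the intersection of two dense sets
    one of which is relatively open; the sum of the normals is continuous along
    the facet and vanishes there. *)
Lemma coincident_normals (q r : face Q) : coincident q r ->
  forall x, mfacet q x -> mnormal r x = - mnormal q x.
Proof.
move=> qr_coin x qx; have [_ qr] := qr_coin.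
apply/eqP; rewrite -addr_eq0 -normr_le0 leNgt; apply/negP => pos.
have mn_cvg p : mfacet p x ->
    mnormal p @ within (mfacet p) (nbhs x) --> mnormal p x.
  by have [/subspace_continuousP + _ _ _] := mnormal_outward p; exact.
have sum_cvg : (fun y => mnormal r y + mnormal q y) @ within (mfacet q) (nbhs x)
    --> mnormal r x + mnormal q x.
  apply: cvgD; last exact: mn_cvg.
  by rewrite qr; apply: mn_cvg; rewrite -qr.
have : \forall y \near within (mfacet q) (nbhs x),
    0 < `|mnormal r y + mnormal q y|.
  by move/cvgr_norm_gt : sum_cvg => sum_pos; exact: sum_pos pos.
rewrite near_withinE => /nbhs_interior near_pos.
have [y [yq y_pos]] := mfacet_interior_dense qx near_pos.
have ry : mfacet r y.
  by rewrite -qr; case: yq => z zq <-; exists z => //; exact: zq.1.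
have [w [wr [w_pos wq]]] := mfacet_interior_dense ry
  (filterI y_pos (mfacet_interior_relatively_open yq)).
have qw : mfacet q w.
  by rewrite qr; case: wr => z zr <-; exists z => //; exact: zr.1.
have := w_pos qw; rewrite (mfacet_interiors_opp qr_coin (wq qw) wr).
by rewrite addNr normr0 ltxx.
Qed.

End CoincidentFacets.

(** * Cancellation across interfaces *)

Section Interfaces.
Context (R : realType) (d : nat) (E : polytope R d) (B : operators E).
Context (Q : mesh E).

Lemma connected_faces_sym (q r : face Q) :
  connected_faces q r -> connected_faces r q.
Proof.
case=> [[qr mqr]|/periodic_sym rq]; [left|by right].
by split; [rewrite eq_sym|].
Qed.

Lemma connected_normals (q r : face Q) c : connected_by q r c ->
  forall x, mfacet q x -> mnormal r (x + c) = - mnormal q x.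
Proof.
case=> [[qr ->] x qx|[_ _]//]; rewrite addr0.
exact: coincident_normals.
Qed.

Lemma mfacet_fnode (q : face Q) i : mfacet q (emap q.1 (fnode B (g:=q.2) i)).
Proof. by exists (fnode B i) => //; exact: fnode_facet. Qed.

(** Each [x i] is moved by [c + c'] to another point of the family; since the
    points are only permuted, their sum does not change. *)
Lemma translations_opp n (x y : 'I_n -> 'rV[R]_d) (s p : 'S_n) c c' (i : 'I_n) :
    (forall i, x i + c = y (s i)) -> (forall i, y i + c' = x (p i)) ->
  c + c' = 0.
Proof.
move=> xy yx.
have : \sum_i (x i + (c + c')) = \sum_i x i.
  rewrite [RHS](reindex_inj (@perm_inj _ (s * p)%g)); apply: eq_bigr => j _.
  by rewrite addrA xy yx permM.
rewrite big_split /= -[RHS]addr0 => /addrI /eqP.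
rewrite sumr_const card_ord -scaler_nat scaler_eq0 pnatr_eq0.
by case: n i {x y s p xy yx} => [[]//|n] _ /eqP.
Qed.

(** The permutations of two partners are inverse to each other as far as the
    positions of the nodes can tell; nodes may be repeated, so the permutations
    themselves need not be inverse. *)
Lemma interface_node_back (tau : forall q : face Q, 'S_(Nf B q.2))
    (q r : face Q) :
    conforming tau -> q \in interface_faces Q -> r \in interface_faces Q ->
    connected_faces q r ->
  forall (e : Nf B q.2 = Nf B r.2) i,
  fnode B (cast_ord (esym e) (tau r (cast_ord e (tau q i)))) = fnode B i.
Proof.
move=> [_ conf] qI rI qr e i.
have [c [e1 [_ qc _]]] := conf q r qI rI qr.
have [c' [e2 [_ rc _]]] := conf r q rI qI (connected_faces_sym qr).
pose s' := fun j : 'I_(Nf B q.2) => cast_ord (esym e) (tau r (cast_ord e j)).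
have s'_inj : injective s'.
  by move=> j k /cast_ord_inj/perm_inj/cast_ord_inj.
have cc' : c + c' = 0.
  apply: (@translations_opp _ (fun i => emap q.1 (fnode B i))
    (fun i => emap r.1 (fnode B (cast_ord e i))) (tau q) (perm s'_inj) c c' i).
    by move=> j; rewrite qc; congr (emap _ (fnode B _)); exact: val_inj.
  move=> j; rewrite rc permE /s'; congr (emap _ (fnode B _)); exact: val_inj.
have := rc (cast_ord e (tau q i)).
have -> : cast_ord e (tau q i) = cast_ord e1 (tau q i) by exact: val_inj.
rewrite -qc -addrA cc' addr0 => /esym eqX.
have -> : cast_ord (esym e) = cast_ord e2 by apply/funext => j; exact: val_inj.
by apply: emap_inj eqX; rewrite inE; apply: facet_body; exact: fnode_facet.
Qed.

Lemma ones_castmx n n' (e : n = n') (A : 'M[R]_n) (b : 'cV[R]_n') :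
  (const_mx 1 : 'cV[R]_n')^T *m castmx (e, e) A *m b
  = (const_mx 1 : 'cV[R]_n)^T *m A *m (\col_i b (cast_ord e i) 0).
Proof.
case: n' / e b => b; congr (_ *m _).
by apply/colP => i; rewrite mxE cast_ord_id.
Qed.

Lemma ones_perm n (s : 'S_n) :
  (const_mx 1 : 'cV[R]_n)^T *m (perm_mx s)^T = (const_mx 1)^T.
Proof.
rewrite -trmx_mul; congr (_ ^T); rewrite -row_permE.
by apply/colP => i; rewrite !mxE.
Qed.

Context (L : conservation_law R d).
Context (u : coefficients B Q L) (uplus : external_data B Q L) (T : R).
Context (u_Ups : forall k x t, body E x -> 0 < t < T -> Ups L (Uh u k x t)).

Lemma fnode_body (g : 'I_(nfacets E)) (i : 'I_(Nf B g)) : body E (fnode B i).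
Proof. exact: facet_body (fnode_facet i). Qed.

(** With [a q] the numerical flux normal to [q], the weight assumption rewrites
    the outflow through [r] as that of the permuted vector [a r] through [q], and
    this permuted vector is [- a q]. *)
Lemma outflow_opp (tau : forall q : face Q, 'S_(Nf B q.2)) (q r : face Q) e t :
    flux_antisymmetric L -> conforming tau -> interface_data u uplus T tau ->
    q \in interface_faces Q -> r \in interface_faces Q ->
    connected_faces q r -> 0 < t < T ->
  outflow u uplus r e t = - outflow u uplus q e t.
Proof.
move=> anti conf data qI rI qr tT.
have [c [en [qrc nodes weights]]] := conf.2 q r qI rI qr.
have rq := connected_faces_sym qr.
pose a (q : face Q) : 'cV[R]_(Nf B q.2) := \col_i numflux L (Uh u q.1 (fnode B i) t)
  (@uplus q i t) (mnormal q (emap q.1 (fnode B i))) 0 e.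
have fstarE p : fstar u uplus p e t = Jf B p *m a p.
  by apply/colP => i; rewrite /Jf mul_diag_mx !mxE.
have outE p : outflow u uplus p e t
    = ((ones (Nf B p.2))^T *m (Wf B p.2 *m Jf B p) *m a p) 0 0.
  by rewrite /outflow fstarE !mulmxA.
rewrite !outE weights ones_castmx.
rewrite !mulmxA ones_perm -!mulmxA.
have -> : perm_mx (tau q) *m (\col_i a r (cast_ord en i) 0) = - a q.
  apply/colP => i; rewrite -row_permE !mxE.
  rewrite (data q r qI rI qr en i t tT).
  rewrite (data r q rI qI rq (esym en) _ t tT).
  rewrite (interface_node_back conf) // -nodes.
  have qi := mfacet_fnode i.
  have [_ unit_normal _ _] := mnormal_outward q.
  rewrite (connected_normals qrc) //.
  rewrite anti ?opprK ?mxE //; try by apply: u_Ups => //; exact: fnode_body.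
  by rewrite norm2N unit_normal.
by rewrite !mulmxN [LHS]mxE.
Qed.

(** The partner map is an involution of the interface facets that changes the
    sign of the outflow, so the sum equals its opposite.  This also covers a
    facet that is its own partner. *)
Lemma interface_sum0 (tau : forall q : face Q, 'S_(Nf B q.2)) e t :
    flux_antisymmetric L -> conforming tau -> interface_data u uplus T tau ->
    0 < t < T ->
  \sum_(q in interface_faces Q) outflow u uplus q e t = 0.
Proof.
move=> anti conf data tT.
have /boolp.choice[s sP] : forall q : face Q, exists r : face Q,
    q \in interface_faces Q -> r \in interface_faces Q /\ connected_faces q r.
  move=> q; have [qI|qI] := boolP (q \in interface_faces Q); last by exists q.
  by have [r [rP _]] := conf.1 q qI; exists r.
have sK : {in interface_faces Q, involutive s}.
  move=> q qI; have [rI qr] := sP q qI; have [ssI sss] := sP _ rI.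
  have [p [_ pP]] := conf.1 (s q) rI.
  rewrite -(pP _ (conj ssI sss)); apply: pP; split => //.
  exact: connected_faces_sym.
have sI q : q \in interface_faces Q -> s q \in interface_faces Q.
  by move=> /sP[].
set S := \sum_(q in _) _.
have : S = - S.
  rewrite {1}/S (reindex_onto s s) => [|q]; last exact: sK.
  rewrite -sumrN; apply: eq_big => [q|q /andP[sqI /eqP ssq]].
    apply/andP/idP => [[sqI /eqP <-]|qI]; first exact: sI.
    by rewrite sI // sK.
  have qI : q \in interface_faces Q by rewrite -ssq; exact: sI.
  by rewrite (outflow_opp _ anti conf data qI sqI) //; exact: (sP q qI).2.
by move/eqP; rewrite -addr_eq0 -mulr2n mulrn_eq0 => /eqP.
Qed.

End Interfaces.

(** * Conservation *)

Theorem theorem4p4 (R : realType) (d : nat) (d_gt0 : (0 < d)%N)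
    (E : polytope R d) (B : operators E) (Q : mesh E)
    (L : conservation_law R d) (T : R)
    (u : coefficients B Q L) (uplus : external_data B Q L)
    (u_Ups : forall k x t, body E x -> 0 < t < T -> Ups L (Uh u k x t))
    (uplus_Ups : forall (q : face Q) (i : 'I_(Nf B q.2)) t, 0 < t < T ->
       Ups L (uplus q i t))
    (V_rank : \rank (Vmx B) = Np B)
    (W_spd : spd (W B))
    (Wf_spd : forall g, spd (Wf B g))
    (Mk_unit : forall k : 'I_(nelem Q), Mk B k \in unitmx)
    (KD0 : forall m, Kmx B *m D B m = 0)
    (MK_spd : spd (Mmx B + Kmx B))
    (const_poly : forall a : R, poly_space (exponents B) (cst a))
    (ddt : discrete_divergence_theorem B)
    (u_derivable : forall k e t, 0 < t < T -> derivable (u k e) t 1)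
    (method :
       ((* when V is only the constants, every D^(m) is 0 and K D^(m) = 0 is void *)
        (Np B = 1%N -> Kmx B = 0) /\
        forall k e t, 0 < t < T -> FR_equation u uplus k e t) \/
       (forall k e t, 0 < t < T -> DG_equation u uplus k e t)) :
  locally_conservative u uplus T /\
  (flux_antisymmetric L ->
   forall tau : (forall q : face Q, 'S_(Nf B q.2)),
     conforming tau -> interface_data u uplus T tau ->
     globally_conservative u uplus T).
Proof.
have [c [Vc Vfc c_partial]] := const_coefficients const_poly.
have local : locally_conservative u uplus T.
  move=> k e t tT; have [du ->] := content_derive (u_derivable k e t tT).
  split=> //; case: method => [[K1 FR]|DG].
    apply: (FR_balance ddt W_spd.1 _ _ _ Vc Vfc (FR k e t tT)).
    - exact/spd_unitmx/mass_spd.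
    - exact: spd_unitmx.
    - have [Np1|/eqP Np1] := eqVneq (Np B) 1%N; first by rewrite K1// mul0mx.
      by have [m [b ->]] := c_partial Np1; rewrite mulmxA KD0 mul0mx.
  exact: (DG_balance ddt Vc Vfc (DG k e t tT)).
split=> // anti tau conf data e t tT.
have -> : (fun s => \sum_k Defs.content u k e s) = \sum_k Defs.content u k e.
  by apply/funext => s; rewrite fct_sumE.
have dc k : derivable (Defs.content u k e) t 1 by have [] := local k e t tT.
split; first exact: derivable_sum.
rewrite derive1E derive_sum//.
have : \sum_k (derive1 (Defs.content u k e) t
    + \sum_g outflow u uplus (k, g) e t) = 0.
  by apply: big1 => k _; have [] := local k e t tT.
rewrite big_split /= pair_bigA /=.
under eq_bigr do rewrite derive1E.
rewrite (bigID (mem (boundary_faces Q))) /=.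
rewrite [X in _ + (_ + X)](_ : _ = 0) ?addr0.
  by move=> bal; rewrite -[RHS]bal; congr (_ + _); apply: eq_bigr => -[].
rewrite -[RHS](interface_sum0 u_Ups e anti conf data tT).
by apply: eq_big => [[k g]|[]]; rewrite ?finset.in_setC.
Qed.
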